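(* Let $\mathcal K=\langle A_1,A_2,A_3\rangle$ be a nondegenerate triangle with centroid $A_0$, split into the subtriangles $\mathcal K_i=\langle A_{i+2},A_0,A_{i+1}\rangle$, $i=1,2,3$ (indices modulo 3). Let $$\mathbb P_5^2(\mathcal K)=\mathbb{PP}_5(\mathcal K)\cap C^2(\mathcal K),\qquad \mathbb{PP}_5(\mathcal K)=\{S\in C^0(\mathcal K): S|_{\mathcal K_i}\in\mathbb P_5,\ i=1,2,3\},$$ where $\mathbb P_5$ is the space of bivariate polynomials of degree at most $5$. Let $\mathcal S$ be a function on $\mathcal K$ such that, for each $i=1,2,3$, its restriction to $\mathcal K_i$ is the polynomial $$\mathcal P_i(\mathcal V)=\sum_{|\beta|=5}C_i(\beta)\,B^5_\beta(\lambda_i)$$ ($\lambda_i$ being the barycentric coordinates of $\mathcal V$ in $\mathcal K_i$) whose Bézier coefficients are given by $$C_i(\beta)=\sum_{|\mu|=5}\widetilde b^{(2)}_{i+2}(\mu)\,B^{\beta_1}_{\mu_1}\!\left(\tfrac53\right)B^{\beta_3}_{\mu_3}\!\left(\tfrac53\right),\qquad |\beta|=5,$$ where the numbers $\widetilde b^{(2)}_{j}(\mu)$, $j=1,2,3$, are obtained from one family of real numbers $\{\widetilde b(\alpha):|\alpha|=3\}$ (common to all $j$) by the subdivision and degree-raising formulas given in the context. Then $\mathcal S\in\mathbb P_5^2(\mathcal K)$.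
   Context: Here $\mathbb N$ contains $0$, multi-indices lie in $\mathbb N^3$, $|\alpha|=\alpha_1+\alpha_2+\alpha_3$, and sums over $|\alpha|=d$ range over all $\alpha\in\mathbb N^3$ with $|\alpha|=d$. Vertex and subtriangle indices are taken modulo 3 with representatives in $\{1,2,3\}$ (the index $0$ in $A_0$ is reserved for the centroid $A_0=\frac13(A_1+A_2+A_3)$). The barycentric coordinates of $\mathcal V$ with respect to a triangle $\langle P_1,P_2,P_3\rangle$ (vertices in the listed order) are the unique $(\lambda_1,\lambda_2,\lambda_3)\in\mathbb R^3$ with $\mathcal V=\sum_j\lambda_jP_j$ and $\lambda_1+\lambda_2+\lambda_3=1$. Bernstein polynomials: for $|\alpha|=d$, $B^d_\alpha(\lambda)=\frac{d!}{\alpha_1!\alpha_2!\alpha_3!}\lambda_1^{\alpha_1}\lambda_2^{\alpha_2}\lambda_3^{\alpha_3}$; for integers $k,n\ge0$, the univariate ones are $B^n_k(t)=\binom nk t^k(1-t)^{n-k}$ if $k\le n$ and $B^n_k(t)=0$ if $k>n$. Construction of $\widetilde b^{(2)}_j(\mu)$. Put $B_i=\frac25A_0+\frac35A_{i+1}$, $i=1,2,3$; $\widetilde{\mathcal K}=\langle B_1,B_2,B_3\rangle$ (whose centroid is $A_0$) and $\widetilde{\mathcal K}_j=\langle B_{j+2},A_0,B_{j+1}\rangle$. The numbers $\widetilde b(\alpha)$, $|\alpha|=3$, are the Bézier coefficients of a polynomial $\widetilde{\mathcal P}=\sum_{|\alpha|=3}\widetilde b(\alpha)B^3_\alpha(\gamma)$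 of degree at most 3, where $\gamma$ are the barycentric coordinates in $\widetilde{\mathcal K}$. (Subdivision.) With $\gamma_0=(\frac13,\frac13,\frac13)$, $\sigma(a,b,c)=(c,a,b)$ and $\rho^0=(\rho_3,\rho_1,0)$, for $j=1,2,3$ and $|\rho|=3$, $$\widetilde b_j(\rho)=\sum_{|\alpha|=\rho_2}\widetilde b\big(\alpha+\sigma^j(\rho^0)\big)B^{\rho_2}_\alpha(\gamma_0).$$ (Double degree raising.) With $\epsilon_k$ the $k$-th canonical basis vector of $\mathbb R^3$ and $\delta_{kl}$ the Kronecker symbol, for $j=1,2,3$ and $|\mu|=5$, $$\widetilde b^{(2)}_j(\mu)=\sum_{k=1}^3\sum_{l=1}^3\frac{\mu_k(\mu_l-\delta_{kl})}{20}\,\widetilde b_j(\mu-\epsilon_k-\epsilon_l),$$ where terms with vanishing factor $\mu_k(\mu_l-\delta_{kl})$ are taken to be $0$ (so negative indices never occur). $C^2(\mathcal K)$ is the space of functions on the closed triangle $\mathcal K$ that are twice continuously differentiable, i.e. whose partial derivatives of order at most 2 exist in the interior and extend continuously to $\mathcal K$. *)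

(* Defs.v *)
From HB Require Import structures.
From mathcomp Require Import all_boot all_order all_algebra.
From mathcomp Require Import -(notations) mpoly.
From mathcomp Require Import all_classical all_reals all_analysis.

Set Implicit Arguments.
Unset Strict Implicit.
Unset Printing Implicit Defensive.

Import Order.TTheory GRing.Theory Num.Theory.
Import numFieldNormedType.Exports.

Local Open Scope classical_set_scope.
Local Open Scope ring_scope.

(* Every index ranging over {1, 2, 3} modulo 3 (vertices, subtriangles,
   components of multi-indices and of barycentric coordinates) has type 'Z_3;
   the representative 3 is the residue 0. *)
Definition triple (T : Type) (x y z : T) : 'Z_3 -> T :=
  fun j => if j == 1 then x else if j == 2 then y else z.

Definition multiindex := {ffun 'Z_3 -> nat}.

Definition mkmi (a b c : nat) : multiindex := [ffun i => triple a b c i].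

Definition addmi (a b : multiindex) : multiindex := [ffun i => (a i + b i)%N].

(* a - eps_k - eps_l, with truncated subtraction. *)
Definition submi2 (a : multiindex) (k l : 'Z_3) : multiindex :=
  [ffun i => (a i - (i == k) - (i == l))%N].

(* Sum over the multi-indices of length d; their components are at most d. *)
Definition misum (R : realType) (d : nat) (F : multiindex -> R) : R :=
  \sum_(a : {ffun 'Z_3 -> 'I_d.+1} | (\sum_(i : 'Z_3) a i == d)%N)
    F [ffun i => nat_of_ord (a i)].

Definition bernstein3 (R : realType) (d : nat) (a : multiindex)
    (l : 'Z_3 -> R) : R :=
  (d`!)%:R / ((a 1)`! * (a 2)`! * (a 3)`!)%:R
    * (l 1 ^+ a 1 * l 2 ^+ a 2 * l 3 ^+ a 3).

(* 'C(n, k) vanishes for k > n, hence so does bernstein1 n k. *)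
Definition bernstein1 (R : realType) (n k : nat) (t : R) : R :=
  'C(n, k)%:R * t ^+ k * (1 - t) ^+ (n - k).

Definition barycentric (R : realType) (P : 'Z_3 -> 'rV[R]_2) (V : 'rV[R]_2)
    (l : 'Z_3 -> R) : Prop :=
  V = \sum_j l j *: P j /\ \sum_j l j = 1.

Definition triangle (R : realType) (P : 'Z_3 -> 'rV[R]_2) : set 'rV[R]_2 :=
  [set V | exists2 l, barycentric P V l & forall j, 0 <= l j].

Definition nondegenerate_triangle (R : realType) (P : 'Z_3 -> 'rV[R]_2) : Prop :=
  free [:: P 2 - P 1; P 3 - P 1].

Definition centroid (R : realType) (P : 'Z_3 -> 'rV[R]_2) : 'rV[R]_2 :=
  3^-1 *: \sum_j P j.

Definition subvertices (R : realType) (A : 'Z_3 -> 'rV[R]_2) (i : 'Z_3) :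
    'Z_3 -> 'rV[R]_2 :=
  triple (A (i + 2)) (centroid A) (A (i + 1)).

(* Let B_i = 2/5 A_0 + 3/5 A_(i+1), with A_0 the centroid. The family b consists
   of the Bezier coefficients of a cubic on <B_1, B_2, B_3>, and subdivide b j
   of those of the same cubic on <B_(j+2), A_0, B_(j+1)>. sigma ^ 3 = id,
   so iterating the residue 0 = 3 times is harmless. *)
Definition sigma (a : multiindex) : multiindex := mkmi (a 3) (a 1) (a 2).

Definition subdivide (R : realType) (b : multiindex -> R) (j : 'Z_3)
    (r : multiindex) : R :=
  misum (r 2) (fun a => b (addmi a (iter j sigma (mkmi (r 3) (r 1) 0)))
                        * bernstein3 (r 2) a (fun=> 3^-1)).

(* Degree raising from 3 to 5; the truncation in submi2 only affects terms
   whose factor vanishes. *)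
Definition raise2 (R : realType) (c : multiindex -> R) (m : multiindex) : R :=
  \sum_(k : 'Z_3) \sum_(l : 'Z_3)
    (m k)%:R * ((m l)%:R - (k == l)%:R) / 20 * c (submi2 m k l).

(* From <B_(i+1), A_0, B_i> to <A_(i+2), A_0, A_(i+1)>: A_(k+1) = 5/3 B_k - 2/3 A_0. *)
Definition extended_coef (R : realType) (b : multiindex -> R) (i : 'Z_3)
    (be : multiindex) : R :=
  misum 5 (fun m => raise2 (subdivide b (i + 2)) m
                    * bernstein1 (be 1) (m 1) (5 / 3)
                    * bernstein1 (be 3) (m 3) (5 / 3)).

Definition bezier (R : realType) (d : nat) (c : multiindex -> R)
    (l : 'Z_3 -> R) : R :=
  misum d (fun be => c be * bernstein3 d be l).

(* mmeasure mdeg p is the total degree of p plus 1 (and 0 if p = 0). *)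
Definition poly_on (R : realType) (d : nat) (D : set 'rV[R]_2)
    (f : 'rV[R]_2 -> R) : Prop :=
  exists2 p : mpoly 2 R, (mmeasure (@mdeg 2) p <= d.+1)%N &
    forall V, D V -> f V = meval (fun i => V 0 i) p.

(* A function on K is represented by a total function of which only the values
   on K matter. *)
Definition PP (R : realType) (d : nat) (A : 'Z_3 -> 'rV[R]_2) :
    set ('rV[R]_2 -> R) :=
  [set f | {within triangle A, continuous f} /\
           forall i, poly_on d (triangle (subvertices A i)) f].

Fixpoint pderiv (R : realType) (s : seq 'I_2) (f : 'rV[R]_2 -> R) :
    'rV[R]_2 -> R :=
  if s is i :: s' then fun x => 'D_(delta_mx 0 i) (pderiv s' f) x else f.

Definition Ck (R : realType) (k : nat) (K : set 'rV[R]_2) :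
    set ('rV[R]_2 -> R) :=
  [set f | [/\ {within K, continuous f},
     forall s i x, (size s < k)%N -> K° x ->
       derivable (pderiv s f) x (delta_mx 0 i)
   & forall s, (size s <= k)%N ->
       exists2 g : 'rV[R]_2 -> R, {within K, continuous g} &
         forall x, K° x -> g x = pderiv s f x]].

Definition PPk (R : realType) (d k : nat) (A : 'Z_3 -> 'rV[R]_2) :
    set ('rV[R]_2 -> R) :=
  PP d A `&` Ck k (triangle A).

(* Main.v *)
Require Import Defs.
From mathcomp Require Import all_boot all_order all_algebra.
From mathcomp Require Import -(notations) mpoly.
From mathcomp Require Import all_classical all_reals all_analysis.
From mathcomp Require Import ring lra zify.

Import Order.TTheory GRing.Theory Num.Theory.
Import numFieldNormedType.Exports.

Local Open Scope classical_set_scope.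
Local Open Scope ring_scope.

(** The three pieces of S are one and the same cubic. Subdivision restricts
the cubic with coefficients b to a subtriangle of <B_1, B_2, B_3>, degree raising
multiplies it by (l_1 + l_2 + l_3) ^ 2 = 1, and the coefficients C_i rewrite the
result in the larger triangle <A_(i+2), A_0, A_(i+1)>, because
A_(k+1) = 5/3 B_k - 2/3 A_0. None of these operations changes the underlying
polynomial, so that S is a polynomial of degree at most 3 on the whole of K, and
smoothness across the interior edges needs no verification.

The algebra rests on the de Casteljau recursion [bezierS]: evaluating a Bezier
form of degree d + 1 at l is the combination with weights l of three Bezier forms
of degree d with shifted coefficients. In umbral terms, bezier d c l is (sum_k l_k E_k) ^ d
applied to c at the index 0, where the E_k are the commuting shifts of the
coefficients. Hence an operation on coefficients that replaces each shift E_k by a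
linear combination sum_m M_km E_m amounts to replacing l by l M
([bezier_linear_change]); subdivision and the passage to the larger triangle are
both of this kind ([bezier_subdivide], [bezier_reparam]), while degree raising is
treated by the dual recursion ([bezier_raise]). Composing them gives
[bezier_extended].

It remains that the subtriangles cover K ([triangle_subvertices]), that
barycentric coordinates in a nondegenerate triangle are affine in the point
([barycentric_affine]), and that a function which agrees with a polynomial on K
is of class C^k there ([Ck_evalp]). *)

(** * Multi-indices and sums over them *)

Lemma Z3_ind (P : 'Z_3 -> Prop) : P 1 -> P 2 -> P 3 -> forall k, P k.
Proof.
move=> P1 P2 P3 [[|[|[|//]]] k3].
- by congr P: P3; apply: val_inj.
- by congr P: P1; apply: val_inj.
- by congr P: P2; apply: val_inj.
Qed.

Lemma sumZ3 (V : nmodType) (F : 'Z_3 -> V) :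
  \sum_k F k = F 1 + F 2 + F 3.
Proof.
rewrite !big_ord_recl big_ord0 addr0 addrC.
by congr (F _ + F _ + F _); apply: val_inj.
Qed.

Lemma triple1 (T : Type) (x y z : T) : triple x y z 1 = x. Proof. by []. Qed.
Lemma triple2 (T : Type) (x y z : T) : triple x y z 2 = y. Proof. by []. Qed.
Lemma triple3 (T : Type) (x y z : T) : triple x y z 3 = z. Proof. by []. Qed.
Definition tripleE := (triple1, triple2, triple3).

Definition weight (a : multiindex) : nat := (\sum_i a i)%N.

Lemma weightE (a : multiindex) :
  weight a = addn (addn (a 1) (a 2)) (a 3).
Proof. exact: sumZ3. Qed.

Definition incmi (k : 'Z_3) (a : multiindex) : multiindex :=
  [ffun i => (a i + (i == k))%N].

Definition decmi (k : 'Z_3) (a : multiindex) : multiindex :=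
  [ffun i => (a i - (i == k))%N].

Lemma incmiK (k : 'Z_3) : cancel (incmi k) (decmi k).
Proof. by move=> a; apply/ffunP => i; rewrite !ffunE addnK. Qed.

Lemma decmiK (k : 'Z_3) (a : multiindex) : (0 < a k)%N -> incmi k (decmi k a) = a.
Proof.
by move=> ak; apply/ffunP => i; rewrite !ffunE subnK//; case: eqP => [->|].
Qed.

Lemma weight_incmi (k : 'Z_3) (a : multiindex) : weight (incmi k a) = (weight a).+1.
Proof.
rewrite /weight (eq_bigr (fun i => a i + (i == k))%N); last first.
  by move=> i _; rewrite ffunE.
by rewrite big_split/= -(big_mkcond (eq_op^~ k))/= big_pred1_eq addn1.
Qed.

Lemma eq_misum (R : realType) (d : nat) (F G : multiindex -> R) :
  (forall a : multiindex, weight a = d -> F a = G a) -> misum d F = misum d G.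
Proof.
move=> FG; apply: eq_bigr => a /eqP ad; apply: FG; rewrite -[RHS]ad.
by apply: eq_bigr => i _; rewrite ffunE.
Qed.

(** The indices a of weight d + 1 with a k > 0 are the [incmi k] a' with a' of
weight d. *)
Lemma misum_incmi (R : realType) (d : nat) (k : 'Z_3) (F : multiindex -> R) :
    (forall a : multiindex, weight a = d.+1 -> a k = 0%N -> F a = 0) ->
  misum d.+1 F = misum d (F \o incmi k).
Proof.
move=> F0; rewrite /misum.
(* v reads a bounded index as a multi-index; up and down are incmi and decmi
   on bounded indices. *)
pose v n (a : {ffun 'Z_3 -> 'I_n.+1}) : multiindex :=
  [ffun i => nat_of_ord (a i)].
have wv n (a : {ffun 'Z_3 -> 'I_n.+1}) : (\sum_i a i)%N = weight (v n a).
  by apply: eq_bigr => i _; rewrite ffunE.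
pose up (a : {ffun 'Z_3 -> 'I_d.+1}) : {ffun 'Z_3 -> 'I_d.+2} :=
  [ffun i => inord (incmi k (v d a) i)].
pose down (a : {ffun 'Z_3 -> 'I_d.+2}) : {ffun 'Z_3 -> 'I_d.+1} :=
  [ffun i => inord (decmi k (v d.+1 a) i)].
have vup a : v d.+1 (up a) = incmi k (v d a).
  apply/ffunP => i; rewrite !ffunE inordK//.
  by have := ltn_ord (a i); case: (i == k); lia.
rewrite (bigID (fun a : {ffun 'Z_3 -> 'I_d.+2} => 0 < a k)%N)/=.
rewrite [X in _ + X]big1 ?addr0; last first.
  move=> a /andP[/eqP ad]; rewrite -leqNgt leqn0 => /eqP ak.
  by rewrite F0// -?wv// ffunE.
have vdown (a : {ffun 'Z_3 -> 'I_d.+2}) : (\sum_i a i == d.+1)%N -> (0 < a k)%N ->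
    v d (down a) = decmi k (v d.+1 a).
  move=> ad ak; apply/ffunP => i; rewrite !ffunE inordK//.
  have [ik|ik] := eqVneq i k; first by have := ltn_ord (a i); lia.
  move: ad; rewrite (bigD1 k)//= (bigD1 i)//= => /eqP ad.
  by rewrite subn0; lia.
rewrite (reindex_onto up down)/=; last first.
  move=> a /andP[ad ak]; apply/ffunP => i; apply: val_inj => /=.
  have := vup (down a); rewrite vdown// decmiK; last by rewrite ffunE.
  by move=> /ffunP/(_ i); rewrite !ffunE.
apply: eq_big => [a|a _]; last first.
  by rewrite -/(v d.+1 (up a)) vup.
rewrite !wv vup weight_incmi eqSS.
have -> : down (up a) = a.
  by apply/ffunP => i; rewrite ffunE vup incmiK ffunE inord_val.
have -> : (0 < up a k)%N.
  by have /ffunP/(_ k) := vup a; rewrite !ffunE eqxx => ->; rewrite addn1.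
by rewrite eqxx !andbT.
Qed.

(** The factor d is the sum of the components of every index; writing it so splits
the sum into three, to each of which [misum_incmi] applies. *)
Lemma misum_weighted (R : realType) (d : nat) (F : multiindex -> R) :
  d%:R * misum d F = \sum_k misum d (fun a => (a k)%:R * F a).
Proof.
rewrite /misum exchange_big/= mulr_sumr; apply: eq_bigr => a /eqP ad.
rewrite -mulr_suml -{1}ad natr_sum; congr (_ * _).
by apply: eq_bigr => k _; rewrite ffunE.
Qed.

(** * De Casteljau recursion *)

Lemma eq_bezier (R : realType) (d : nat) (c c' : multiindex -> R) (l : 'Z_3 -> R) :
  (forall a, weight a = d -> c a = c' a) -> bezier d c l = bezier d c' l.
Proof. by move=> cc'; apply: eq_misum => a /cc' ->. Qed.

Lemma bezier_sum (R : realType) (d : nat) (w : 'Z_3 -> R)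
    (c : 'Z_3 -> multiindex -> R) (l : 'Z_3 -> R) :
  bezier d (fun a => \sum_k w k * c k a) l = \sum_k w k * bezier d (c k) l.
Proof.
rewrite /bezier /misum; under [RHS]eq_bigr do rewrite mulr_sumr.
rewrite exchange_big; apply: eq_bigr => a _.
by rewrite mulr_suml; apply: eq_bigr => k _; rewrite mulrA.
Qed.

Lemma bernstein3_incmi (R : realType) (d : nat) (k : 'Z_3) a (l : 'Z_3 -> R) :
  (incmi k a k)%:R * bernstein3 d.+1 (incmi k a) l
  = d.+1%:R * (l k * bernstein3 d a l).
Proof.
rewrite /bernstein3 !ffunE.
have f0 n : n`!%:R != 0 :> R by rewrite pnatr_eq0 -lt0n fact_gt0.
have S0 n : 1 + n%:R != 0 :> R by rewrite nat1r pnatr_eq0.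
by elim/Z3_ind: k => /=; rewrite ?addn0 ?addn1 !factS !natrM !exprS; field;
  rewrite ?f0 ?S0.
Qed.

(** The coefficient a_k turns the multinomial (d + 1)! / a! into
(d + 1) (d! / (a - e_k)!), and the indices with a_k = 0 disappear. Both the de
Casteljau recursion and degree raising follow from this identity. *)
Lemma bezier_weight (R : realType) (d : nat) (k : 'Z_3)
    (c : multiindex -> R) (l : 'Z_3 -> R) :
  bezier d.+1 (fun a => (a k)%:R * c a) l
  = d.+1%:R * (l k * bezier d (c \o incmi k) l).
Proof.
rewrite /bezier (@misum_incmi _ _ k) => [|a _ ->]; last by rewrite !mul0r.
rewrite /misum !mulr_sumr; apply: eq_bigr => a _ /=.
by rewrite mulrAC bernstein3_incmi; ring.
Qed.

Lemma bezierS (R : realType) (d : nat) (c : multiindex -> R) (l : 'Z_3 -> R) :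
  bezier d.+1 c l = \sum_k l k * bezier d (c \o incmi k) l.
Proof.
apply: (mulfI (_ : d.+1%:R != 0)); first by rewrite pnatr_eq0.
rewrite misum_weighted mulr_sumr; apply: eq_bigr => k _.
by rewrite -bezier_weight; apply: eq_misum => a _; rewrite mulrA.
Qed.

Lemma misum0 (R : realType) (F : multiindex -> R) :
  misum 0 F = F (mkmi 0 0 0).
Proof.
rewrite /misum (big_pred1 [ffun=> ord0]) => [|a].
  congr F; apply/ffunP => i; rewrite !ffunE /triple.
  by do 2?case: ifP.
apply/eqP/eqP => [_|->]; last by apply: big1 => i _; rewrite ffunE.
by apply/ffunP => i; rewrite ffunE ord1.
Qed.

Lemma bezier0 (R : realType) (c : multiindex -> R) (l : 'Z_3 -> R) :
  bezier 0 c l = c (mkmi 0 0 0).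
Proof.
by rewrite /bezier misum0 /bernstein3 !ffunE /= !expr0 fact0 !muln1 invr1 !mulr1.
Qed.

(** The factor (m k) makes the truncation in [decmi] harmless. *)
Definition raise {R : realType} (d : nat) (c : multiindex -> R)
    (m : multiindex) : R :=
  \sum_k d.+1%:R^-1 * ((m k)%:R * c (decmi k m)).

Lemma bezier_raise (R : realType) (d : nat) (c : multiindex -> R) (l : 'Z_3 -> R) :
  bezier d.+1 (raise d c) l = (\sum_k l k) * bezier d c l.
Proof.
rewrite bezier_sum mulr_suml; apply: eq_bigr => k _.
rewrite bezier_weight mulKf ?pnatr_eq0//; congr (_ * _).
by apply: eq_misum => a _ /=; rewrite incmiK.
Qed.

(** The factor m_l - delta_kl is the l-th component of m - e_k, as the terms with
m_k = 0 vanish. *)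
Lemma raise2E (R : realType) (c : multiindex -> R) :
  raise2 c =1 raise 4 (raise 3 c).
Proof.
move=> m; apply: eq_bigr => k _; rewrite /raise !mulr_sumr; apply: eq_bigr => l _.
have -> : submi2 m k l = decmi l (decmi k m).
  by apply/ffunP => i; rewrite !ffunE.
have [->|mk] := posnP (m k); first by rewrite !mul0r mulr0.
have -> : (decmi k m l)%:R = (m l)%:R - (k == l)%:R :> R.
  by rewrite ffunE (eq_sym l k) natrB//; case: eqP => // <-.
by field.
Qed.

(** * Linear changes of barycentric coordinates *)

(** If the shift by e_k of the transformed coefficients is the combination with
weights M k of the transforms of shifted coefficients, then the recursion [bezierS]
on both sides shows that T substitutes l M for l. *)
Lemma bezier_linear_change (R : realType)
    (T : nat -> (multiindex -> R) -> multiindex -> R) (M : 'Z_3 -> 'Z_3 -> R) :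
    (forall c, T 0%N c (mkmi 0 0 0) = c (mkmi 0 0 0)) ->
    (forall d c a k, weight a = d ->
      T d.+1 c (incmi k a) = \sum_m M k m * T d (c \o incmi m) a) ->
  forall d c l,
    bezier d (T d c) l = bezier d c (fun m => \sum_k l k * M k m).
Proof.
move=> T0 TS; elim=> [c l|d IH c l]; first by rewrite !bezier0.
have step k : bezier d (T d.+1 c \o incmi k) l
    = \sum_m M k m * bezier d (T d (c \o incmi m)) l.
  by rewrite -bezier_sum; apply: eq_bezier => a ad; exact: TS.
rewrite !bezierS (eq_bigr _ (fun k _ => congr1 ( *%R (l k)) (step k))).
under eq_bigr do rewrite mulr_sumr.
rewrite exchange_big; apply: eq_bigr => m _ /=; rewrite -IH mulr_suml.
by apply: eq_bigr => k _; rewrite mulrA.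
Qed.

(** * Subdivision, and passage to the larger triangle *)

Lemma addmi_incmi (k : 'Z_3) (a v : multiindex) :
  addmi (incmi k a) v = incmi k (addmi a v).
Proof. by apply/ffunP => i; rewrite !ffunE addnAC. Qed.

Lemma addmiC (a v : multiindex) : addmi a v = addmi v a.
Proof. by apply/ffunP => i; rewrite !ffunE addnC. Qed.

Lemma sigma_incmi (k : 'Z_3) (a : multiindex) :
  sigma (incmi k a) = incmi (k + 1) (sigma a).
Proof.
by apply/ffunP; elim/Z3_ind => /=; rewrite !ffunE /=; elim/Z3_ind: k.
Qed.

Lemma iter_sigma_incmi (n : nat) (k : 'Z_3) (a : multiindex) :
  iter n sigma (incmi k a) = incmi (k + n%:R) (iter n sigma a).
Proof.
elim: n => [|n IH]; first by rewrite addr0.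
by rewrite !iterS IH sigma_incmi -natr1 addrA.
Qed.

Lemma sigma0 : sigma (mkmi 0 0 0) = mkmi 0 0 0.
Proof. by apply/ffunP; elim/Z3_ind; rewrite !ffunE. Qed.

Lemma subdivideE (R : realType) (c : multiindex -> R) (j : 'Z_3)
    (r : multiindex) :
  subdivide c j r = bezier (r 2)
    (fun a => c (addmi a (iter j sigma (mkmi (r 3) (r 1) 0)))) (fun=> 3^-1).
Proof. by []. Qed.

(** The new vertices are B_(j+2), A_0 and B_(j+1), of which A_0 has coordinates
(1/3, 1/3, 1/3): a shift in the first or third direction is a shift of c by one
unit vector, transported by sigma, and a shift in the second direction is a step of
the de Casteljau algorithm at A_0. *)
Lemma bezier_subdivide (R : realType) (d : nat) (c : multiindex -> R)
    (j : 'Z_3) (l : 'Z_3 -> R) :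
  bezier d (subdivide c j) l
  = bezier d c (fun m => l 1 * (m == j + 2)%:R + l 2 / 3 + l 3 * (m == j + 1)%:R).
Proof.
pose M : 'Z_3 -> 'Z_3 -> R := triple (fun m => (m == j + 2)%:R) (fun=> 3^-1)
                                     (fun m => (m == j + 1)%:R).
rewrite (@bezier_linear_change _ (fun _ c => subdivide c j) M).
- by congr bezier; apply/funext => m; rewrite sumZ3.
- move=> {}c; rewrite subdivideE {1}ffunE.
  rewrite bezier0; congr c.
  rewrite !ffunE; have -> : iter j sigma (mkmi 0 0 0) = mkmi 0 0 0.
    by elim: (j : nat) => //= n ->; exact: sigma0.
  by apply/ffunP; elim/Z3_ind; rewrite !ffunE.
move=> {}d {}c a k _.
rewrite subdivideE /M; elim/Z3_ind: k; under [RHS]eq_bigr do rewrite tripleE.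
- rewrite (_ : mkmi _ _ _ = incmi 2 (mkmi (a 3) (a 1) 0)); last first.
    by apply/ffunP; elim/Z3_ind; rewrite !ffunE /= ?ffunE.
  rewrite iter_sigma_incmi natr_Zp ffunE addn0 (bigD1 (j + 2))//= eqxx mul1r.
  rewrite big1 ?addr0 => [|m /negPf->]; last by rewrite mul0r.
  rewrite subdivideE; apply: eq_bezier => r _ /=.
  by rewrite [2 + j]addrC addmiC addmi_incmi addmiC.
- rewrite (_ : mkmi _ _ _ = mkmi (a 3) (a 1) 0); last first.
    by apply/ffunP; elim/Z3_ind; rewrite !ffunE /= ?ffunE ?addn0.
  rewrite ffunE addn1 bezierS; apply: eq_bigr => m _; congr (_ * _).
  by rewrite subdivideE; apply: eq_bezier => r _ /=; rewrite addmi_incmi.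
- rewrite (_ : mkmi _ _ _ = incmi 1 (mkmi (a 3) (a 1) 0)); last first.
    by apply/ffunP; elim/Z3_ind; rewrite !ffunE /= ?ffunE.
  rewrite iter_sigma_incmi natr_Zp ffunE addn0 (bigD1 (j + 1))//= eqxx mul1r.
  rewrite big1 ?addr0 => [|m /negPf->]; last by rewrite mul0r.
  rewrite subdivideE; apply: eq_bezier => r _ /=.
  by rewrite [1 + j]addrC addmiC addmi_incmi addmiC.
Qed.

Lemma bernstein1_gt (R : realType) (n k : nat) (t : R) :
  (n < k)%N -> bernstein1 n k t = 0.
Proof. by move=> nk; rewrite /bernstein1 bin_small// !mul0r. Qed.

(** Pascal's rule. *)
Lemma bernstein1S (R : realType) (n k : nat) (t : R) :
  bernstein1 n.+1 k t =
  t * (if k is k'.+1 then bernstein1 n k' t else 0) + (1 - t) * bernstein1 n k t.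
Proof.
rewrite /bernstein1; case: k => [|k].
  by rewrite !bin0 !subn0 exprS; ring.
have [nk|kn] := leqP n k.
  rewrite binS bin_small; first by rewrite subSS exprS; ring.
  by rewrite ltnS.
by rewrite binS natrD subSS -(subnSK kn) !exprS; ring.
Qed.

(** Bezier coefficients after moving the vertices P_1 and P_3 to
t P_1 + (1 - t) P_2 and t P_3 + (1 - t) P_2. *)
Definition reparam {R : realType} (t : R) (d : nat) (c : multiindex -> R)
    (be : multiindex) : R :=
  misum d (fun m => c m * bernstein1 (be 1) (m 1) t
                        * bernstein1 (be 3) (m 3) t).

(** Raising the first degree of the index splits B^(n+1)_k by Pascal's rule into a part
with factor t, which shifts c in the first direction, and a part with factor
1 - t, which shifts c in the second direction, and likewise for the third
degree. *)
Lemma bezier_reparam (R : realType) (t : R) (d : nat) (c : multiindex -> R)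
    (l : 'Z_3 -> R) :
  bezier d (reparam t d c) l
  = bezier d c (triple (t * l 1) ((1 - t) * l 1 + l 2 + (1 - t) * l 3) (t * l 3)).
Proof.
pose M : 'Z_3 -> 'Z_3 -> R :=
  triple (triple t (1 - t) 0) (triple 0 1 0) (triple 0 (1 - t) t).
rewrite (@bezier_linear_change _ (reparam t) M).
- by congr bezier; apply/funext; elim/Z3_ind; rewrite sumZ3 /M !tripleE; ring.
- move=> {}c; rewrite /reparam misum0 !ffunE /=.
  by rewrite /bernstein1 !expr0 bin0 !mulr1.
move=> {}d {}c a k; rewrite weightE => ad; rewrite sumZ3.
(* If m_2 = 0 then m_1 + m_3 = d + 1 > a_1 + a_3, so one of the two Bernstein
   factors vanishes. *)
have vanish (m : multiindex) : weight m = d.+1 -> m 2 = 0%N ->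
    c m * bernstein1 (a 1) (m 1) t * bernstein1 (a 3) (m 3) t = 0.
  rewrite weightE => + m2; rewrite m2 => md.
  have [/bernstein1_gt->|m1] := ltnP (a 1) (m 1); first by rewrite mulr0 mul0r.
  by rewrite [X in _ * X]bernstein1_gt ?mulr0//; lia.
have lower : misum d.+1 (fun m => c m * bernstein1 (a 1) (m 1) t
      * bernstein1 (a 3) (m 3) t) = reparam t d (c \o incmi 2) a.
  rewrite (@misum_incmi _ _ 2)//; apply: eq_misum => m _ /=.
  by rewrite !ffunE !addn0.
elim/Z3_ind: k; rewrite /M !tripleE !(mul0r, addr0, add0r).
- rewrite -lower /reparam !ffunE /= addn0 addn1.
  pose up (m : multiindex) := if m 1 is p.+1 then bernstein1 (a 1) p t else 0.
  have -> : misum d (fun m => (c \o incmi 1) m * bernstein1 (a 1) (m 1) t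
        * bernstein1 (a 3) (m 3) t)
      = misum d.+1 (fun m => c m * up m * bernstein1 (a 3) (m 3) t).
    rewrite [RHS](@misum_incmi _ _ 1) => [|m _ m1]; last first.
      by rewrite /up m1 mulr0 mul0r.
    by apply: eq_misum => m _; rewrite /up /= !ffunE /= addn1 addn0.
  rewrite /misum !mulr_sumr -big_split; apply: eq_bigr => m _ /=.
  by rewrite bernstein1S -/(up _); ring.
- by rewrite mul1r -lower /reparam !ffunE /= !addn0.
- rewrite -lower /reparam !ffunE /= addn0 addn1.
  pose up (m : multiindex) := if m 3 is p.+1 then bernstein1 (a 3) p t else 0.
  have -> : misum d (fun m => (c \o incmi 3) m * bernstein1 (a 1) (m 1) t
        * bernstein1 (a 3) (m 3) t)
      = misum d.+1 (fun m => c m * bernstein1 (a 1) (m 1) t * up m).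
    rewrite [RHS](@misum_incmi _ _ 3) => [|m _ m3]; last first.
      by rewrite /up m3 mulr0.
    by apply: eq_misum => m _; rewrite /up /= !ffunE /= addn1 addn0.
  rewrite /misum !mulr_sumr -big_split; apply: eq_bigr => m _ /=.
  by rewrite bernstein1S -/(up _); ring.
Qed.

(** The right-hand side no longer involves the subtriangle: if m |-> L m are the
barycentric coordinates in K of the point with coordinates l in K_i, its argument
is m |-> 5/3 L (m + 1) - 2/9, the barycentric coordinates in <B_1, B_2, B_3>:
as B_m = 2/5 A_0 + 3/5 A_(m+1), a point with coordinates g there has
L (m + 1) = 2/15 + 3/5 g m. *)
Lemma bezier_extended (R : realType) (b : multiindex -> R) (i : 'Z_3)
    (l : 'Z_3 -> R) : \sum_j l j = 1 ->
  bezier 5 (extended_coef b i) l = bezier 3 b (fun m =>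
     5 / 3 * (l 1 * (m == i + 1)%:R + l 2 / 3 + l 3 * (m == i)%:R) - 2 / 9).
Proof.
rewrite sumZ3 => l1.
have -> : bezier 5 (extended_coef b i) l
    = bezier 5 (reparam (5 / 3) 5 (raise2 (subdivide b (i + 2)))) l by [].
rewrite bezier_reparam (@eq_bezier _ 5 _ (raise 4 (raise 3 (subdivide b (i + 2)))));
  last by move=> a _; exact: raise2E.
rewrite !bezier_raise bezier_subdivide sumZ3 !tripleE.
set s := (_ + _ + _); have -> : s = 1 by rewrite /s; lra.
rewrite !mul1r; congr bezier; apply/funext => m.
have -> : i + 2 + 2 = i + 1 by rewrite -addrA; congr (i + _); exact: val_inj.
have -> : i + 2 + 1 = i by rewrite -addrA -[RHS]addr0; congr (i + _); exact: val_inj.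
have -> : l 2 = 1 - l 1 - l 3 by lra.
by field.
Qed.

(** * Polynomial functions of two variables *)

Definition evalp {R : realType} (p : mpoly 2 R) (V : 'rV[R]_2) : R :=
  meval (fun i => V 0 i) p.

Lemma evalpC (R : realType) (c : R) : evalp (mpolyC 2 c) = cst c.
Proof. by apply/funext => V; exact: mevalC. Qed.

Lemma evalpU (R : realType) (j : 'I_2) :
  evalp (mpolyX R (mnm1 j)) = (fun V : 'rV[R]_2 => V 0 j).
Proof. by apply/funext => V; exact: mevalXU. Qed.

Lemma evalpD (R : realType) (p q : mpoly 2 R) :
  evalp (p + q) = evalp p + evalp q.
Proof. by apply/funext => V; exact: mevalD. Qed.

Lemma evalpM (R : realType) (p q : mpoly 2 R) :
  evalp (p * q) = evalp p * evalp q.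
Proof. by apply/funext => V; exact: mevalM. Qed.

(** Continuity and partial derivatives are compatible with the ring operations, so
that this induction dispenses with computations on monomials. *)
Lemma mpoly_ring_ind (n : nat) (R : comNzRingType) (P : mpoly n R -> Prop) :
  (forall c, P (mpolyC n c)) -> (forall j, P (mpolyX R (mnm1 j))) ->
  (forall p q, P p -> P q -> P (p + q)) ->
  (forall p q, P p -> P q -> P (p * q)) ->
  forall p, P p.
Proof.
move=> PC PX PD PM; elim/mpolyind => [|c m p _ _ IH]; first exact: (PC 0).
apply: (PD _ _ _ IH); rewrite -mul_mpolyC mpolyXE_id; apply: (PM _ _ (PC c)).
elim/big_ind: _ => //; first exact: (PC 1).
move=> j _; elim: (m j) => [|k IHk]; first exact: (PC 1).
by rewrite exprS; apply: PM.
Qed.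

Lemma evalp_continuous (R : realType) (p : mpoly 2 R) : continuous (evalp p).
Proof.
elim/mpoly_ring_ind: p => [c|j|p q cp cq|p q cp cq] V.
- by rewrite evalpC; exact: cst_continuous.
- by rewrite evalpU; exact: coord_continuous.
- by rewrite evalpD; exact: (cvgD (cp V) (cq V)).
- by rewrite evalpM; exact: (cvgM (cp V) (cq V)).
Qed.

Lemma is_derive_coord (R : realType) (V v : 'rV[R]_2) (j : 'I_2) :
  is_derive V v (fun W : 'rV[R]_2 => W 0 j) (v 0 j).
Proof.
have lim : (fun h : R => h^-1 *: ((h *: v + V) 0 j - V 0 j)) @ 0^' --> v 0 j.
  apply: cvg_near_cst; near=> h.
  rewrite !mxE addrK /GRing.scale /= mulKf//.
  by near: h; exact: nbhs_dnbhs_neq.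
apply: DeriveDef; first by apply/cvg_ex; exists (v 0 j).
exact: cvg_lim lim.
Unshelve. all: by end_near. Qed.

Lemma is_derive_evalp (R : realType) (p : mpoly 2 R) (V : 'rV[R]_2) (i : 'I_2) :
  is_derive V (delta_mx 0 i) (evalp p) (evalp (mderiv i p) V).
Proof.
elim/mpoly_ring_ind: p => [c|j|p q dp dq|p q dp dq].
- by rewrite mderivC !evalpC; exact: is_derive_cst.
- have <- : (delta_mx 0 i : 'rV[R]_2) 0 j = evalp (mderiv i (mpolyX R (mnm1 j))) V.
    rewrite mderivX /evalp mevalZ mevalX mnm1E !mxE eqxx /=.
    have [->|] := eqVneq i j; last by rewrite eq_sym mul0r.
    by rewrite mul1r big1// => k _; rewrite mnmBE subnn expr0.
  by rewrite evalpU; exact: is_derive_coord.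
- by rewrite mderivD !evalpD; exact: is_deriveD.
- rewrite mderivM evalpD !evalpM; suff -> : (evalp (mderiv i p) * evalp q
      + evalp p * evalp (mderiv i q)) V = evalp p V *: evalp (mderiv i q) V
      + evalp q V *: evalp (mderiv i p) V by exact: is_deriveM.
  by rewrite addrC /GRing.scale/= [X in _ + X]mulrC.
Qed.

(** Affine coordinates q turn a Bezier form of degree d into a polynomial of
degree d: each step of the de Casteljau recursion multiplies by affine functions. *)
Lemma bezier_poly (R : realType) (d : nat) (c : multiindex -> R)
    (q : 'Z_3 -> mpoly 2 R) :
  (forall k, mmeasure (@mdeg 2) (q k) <= 2)%N ->
  exists2 p : mpoly 2 R, (mmeasure (@mdeg 2) p <= d.+1)%N &
    forall V, evalp p V = bezier d c (fun k => evalp (q k) V).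
Proof.
move=> q2; elim: d c => [|d IH] c.
  exists (mpolyC 2 (c (mkmi 0 0 0))); first by rewrite mmeasureC; case: eqP.
  by move=> V; rewrite bezier0 /evalp mevalC.
have [p1 s1 E1] := IH (c \o incmi 1).
have [p2 s2 E2] := IH (c \o incmi 2).
have [p3 s3 E3] := IH (c \o incmi 3).
exists (q 1 * p1 + q 2 * p2 + q 3 * p3); last first.
  by move=> V; rewrite bezierS sumZ3 -E1 -E2 -E3 /evalp !mevalD !mevalM.
have sM k p : (mmeasure (@mdeg 2) p <= d.+1 -> mmeasure (@mdeg 2) (q k * p) <= d.+2)%N.
  move=> sp; have [->|q0] := eqVneq (q k) 0; first by rewrite mul0r mmeasure0.
  have [->|p0] := eqVneq p 0; first by rewrite mulr0 mmeasure0.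
  by rewrite msizeM// -subn1 leq_subLR (leq_add (q2 k) sp).
rewrite (leq_trans (mmeasureD_le _ _ _))// geq_max sM// andbT.
by rewrite (leq_trans (mmeasureD_le _ _ _))// geq_max !sM.
Qed.

Lemma within_continuous_evalp (R : realType) (K : set 'rV[R]_2)
    (f : 'rV[R]_2 -> R) (p : mpoly 2 R) :
  (forall V, K V -> f V = evalp p V) -> {within K, continuous f}.
Proof.
move=> fp; apply: (@subspace_eq_continuous _ _ _ (evalp p)).
  by move=> V /set_mem /fp.
exact/continuous_subspaceT/evalp_continuous.
Qed.

(** In the interior the iterated partial derivatives of f are those of p, which are
polynomials and therefore continuous everywhere. *)
Lemma Ck_evalp (R : realType) (K : set 'rV[R]_2) (k : nat)
    (f : 'rV[R]_2 -> R) (p : mpoly 2 R) :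
  (forall V, K V -> f V = evalp p V) -> Ck k K f.
Proof.
move=> fp.
have pd s : forall V, K° V -> evalp (foldr (@mderiv 2 R) p s) V = pderiv s f V.
  elim: s => [V /interior_subset /fp //|i s IH V KV] /=.
  have [_ <-] := is_derive_evalp _ (foldr (@mderiv 2 R) p s) V i.
  apply: near_eq_derive; near=> W; apply: IH.
  by near: W; exact: nbhs_interior.
split=> [|s i V _ KV|s _]; first exact: within_continuous_evalp fp.
- have [+ _] := is_derive_evalp _ (foldr (@mderiv 2 R) p s) V i.
  apply: near_eq_derivable; near=> W; apply: pd.
  by near: W; exact: nbhs_interior.
- exists (evalp (foldr (@mderiv 2 R) p s)); last exact: pd.
  exact/continuous_subspaceT/evalp_continuous.
Unshelve. all: by end_near. Qed.

Definition affine_poly {R : realType} (a u v : R) : mpoly 2 R :=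
  mpolyC 2 a + (u *: mpolyX R (mnm1 0) + v *: mpolyX R (mnm1 1)).

Lemma affine_polyE (R : realType) (a u v : R) (V : 'rV[R]_2) :
  evalp (affine_poly a u v) V = a + (u * V 0 0 + v * V 0 1).
Proof. by rewrite /evalp !mevalD !mevalZ mevalC !mevalXU. Qed.

Lemma affine_poly_size (R : realType) (a u v : R) :
  (mmeasure (@mdeg 2) (affine_poly a u v) <= 2)%N.
Proof.
have sX c j : (mmeasure (@mdeg 2) (c *: mpolyX R (mnm1 j)) <= 2)%N.
  by rewrite (leq_trans (mmeasureZ_le _ _ _))// msizeX mdeg1.
rewrite (leq_trans (mmeasureD_le _ _ _))// geq_max mmeasureC.
rewrite (leq_trans (leq_b1 _))//= (leq_trans (mmeasureD_le _ _ _))//.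
by rewrite geq_max !sX.
Qed.

(** * Barycentric coordinates *)

Lemma sumZ3_shift {V : nmodType} (i : 'Z_3) (F : 'Z_3 -> V) :
  \sum_k F k = F (i + 1) + F (i + 2) + F i.
Proof.
rewrite (reindex_inj (addrI i)) sumZ3; congr (_ + _ + F _).
by rewrite -[RHS]addr0; congr (i + _); exact: val_inj.
Qed.

Lemma eqZ3 (i : 'Z_3) :
  (((i + 1 == i + 2) = false) * ((i + 2 == i + 1) = false))
  * (((i == i + 1) = false) * ((i == i + 2) = false)).
Proof. by elim/Z3_ind: i. Qed.

Lemma sum_subvertices (R : realType) (A : 'Z_3 -> 'rV[R]_2) (i : 'Z_3)
    (l : 'Z_3 -> R) :
  \sum_j l j *: subvertices A i j
  = \sum_m (l 1 * (m == i + 2)%:R + l 2 / 3 + l 3 * (m == i + 1)%:R) *: A m.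
Proof.
rewrite sumZ3 /subvertices !tripleE /centroid !(sumZ3_shift i).
rewrite !eqxx !eqZ3 !(mulr1, mulr0, addr0, add0r).
by apply/rowP => c; rewrite !mxE /=; ring.
Qed.

Lemma barycentric_subvertices (R : realType) (A : 'Z_3 -> 'rV[R]_2) (i : 'Z_3)
    (V : 'rV[R]_2) (l : 'Z_3 -> R) :
  barycentric (subvertices A i) V l ->
  barycentric A V
    (fun m => l 1 * (m == i + 2)%:R + l 2 / 3 + l 3 * (m == i + 1)%:R).
Proof.
move=> [-> l1]; split; first exact: sum_subvertices.
rewrite (sumZ3_shift i) !eqxx !eqZ3 !(mulr1, mulr0, addr0, add0r).
by rewrite -[RHS]l1 sumZ3; field.
Qed.

(** A point lies in the subtriangle opposite to a vertex A_i at which its barycentric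
coordinate is smallest: after subtraction of 3 l_i A_0 = l_i sum_m A_m, the weights
l_m - l_i of the other two vertices are still nonnegative. *)
Lemma triangle_subvertices (R : realType) (A : 'Z_3 -> 'rV[R]_2)
    (V : 'rV[R]_2) :
  triangle A V -> exists i, triangle (subvertices A i) V.
Proof.
move=> [l [-> l1] l0].
have [i lmin] : exists i, forall m, l i <= l m.
  by case: (@Order.TotalTheory.arg_minP _ _ _ (1 : 'Z_3) xpredT l isT) => i _ lmin;
    exists i => m; exact: lmin.
exists i, (triple (l (i + 2) - l i) (3 * l i) (l (i + 1) - l i)).
  split; last first.
    by rewrite sumZ3 !tripleE -[RHS]l1 (sumZ3_shift i); ring.
  rewrite sum_subvertices !tripleE !(sumZ3_shift i).
  rewrite !eqxx !eqZ3 !(mulr1, mulr0, addr0, add0r).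
  by apply/rowP => c; rewrite !mxE; field.
by elim/Z3_ind; rewrite tripleE ?subr_ge0// mulr_ge0.
Qed.

Definition cross {R : realType} (u v : 'rV[R]_2) : R :=
  u 0 0 * v 0 1 - u 0 1 * v 0 0.

Lemma free_cross (R : realType) (u v : 'rV[R]_2) :
  free [:: u; v] -> cross u v != 0.
Proof.
have eq_rV2 (x y : 'rV[R]_2) : x 0 0 = y 0 0 -> x 0 1 = y 0 1 -> x = y.
  by move=> e0 e1; apply/rowP; case=> [[|[|//]] k2];
    [rewrite -[Ordinal k2](_ : 0 = _)|rewrite -[Ordinal k2](_ : 1 = _)] => //;
    exact: val_inj.
rewrite free_cons seq1_free span_seq1 => /andP[uv v0]; apply: contra uv.
rewrite /cross subr_eq0 => /eqP uv; apply/vlineP.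
have [v00|v00] := eqVneq (v 0 0) 0; last first.
  exists (u 0 0 / v 0 0); apply: eq_rV2; rewrite !mxE ?divfK//.
  by rewrite mulrAC uv mulfK.
have v01 : v 0 1 != 0.
  by apply: contra v0 => /eqP v01; apply/eqP/eq_rV2; rewrite !mxE.
exists (u 0 1 / v 0 1); apply: eq_rV2; rewrite !mxE ?divfK//.
by rewrite mulrAC -uv mulfK.
Qed.

(** Cramer's rule, with determinant D. *)
Lemma barycentric_affine (R : realType) (A : 'Z_3 -> 'rV[R]_2) :
    nondegenerate_triangle A ->
  exists a u v : 'Z_3 -> R, forall V l, barycentric A V l ->
    forall k, l k = a k + (u k * V 0 0 + v k * V 0 1).
Proof.
move=> /free_cross; rewrite /cross !mxE; set D := (_ - _) => D0.
pose a2 := (A 1 0 1 * A 3 0 0 - A 1 0 0 * A 3 0 1) / D.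
pose u2 := (A 3 0 1 - A 1 0 1) / D.
pose v2 := (A 1 0 0 - A 3 0 0) / D.
pose a3 := (A 1 0 0 * A 2 0 1 - A 1 0 1 * A 2 0 0) / D.
pose u3 := (A 1 0 1 - A 2 0 1) / D.
pose v3 := (A 2 0 0 - A 1 0 0) / D.
exists (triple (1 - a2 - a3) a2 a3), (triple (- u2 - u3) u2 u3),
  (triple (- v2 - v3) v2 v3) => V l [-> /[!sumZ3] l1].
have l1E : l 1 = 1 - l 2 - l 3 by lra.
have l2E : l 2 = a2 + (u2 * (l 1 * A 1 0 0 + l 2 * A 2 0 0 + l 3 * A 3 0 0)
    + v2 * (l 1 * A 1 0 1 + l 2 * A 2 0 1 + l 3 * A 3 0 1)).
  by rewrite l1E /a2 /u2 /v2 /D; field.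
have l3E : l 3 = a3 + (u3 * (l 1 * A 1 0 0 + l 2 * A 2 0 0 + l 3 * A 3 0 0)
    + v3 * (l 1 * A 1 0 1 + l 2 * A 2 0 1 + l 3 * A 3 0 1)).
  by rewrite l1E /a3 /u3 /v3 /D; field.
elim/Z3_ind; rewrite !tripleE !mxE //.
by rewrite [LHS]l1E [X in 1 - X - _]l2E [X in _ - X = _]l3E; ring.
Qed.

(** * The spline *)

Theorem proposition3p5 (R : realType) (A : 'Z_3 -> 'rV[R]_2)
    (b : multiindex -> R) (S : 'rV[R]_2 -> R) :
  nondegenerate_triangle A ->
  (forall (i : 'Z_3) (V : 'rV[R]_2) (l : 'Z_3 -> R),
     triangle (subvertices A i) V ->
     barycentric (subvertices A i) V l ->
     S V = bezier 5 (extended_coef b i) l) ->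
  PPk 5 2 A S.
Proof.
move=> /barycentric_affine[a [u [v lE]]] SE.
(* The barycentric coordinates in <B_1, B_2, B_3>, as polynomials in the point. *)
pose q k := affine_poly (5 / 3 * a (k + 1) - 2 / 9) (5 / 3 * u (k + 1))
  (5 / 3 * v (k + 1)).
have [p p4 pE] := bezier_poly R 3 b q (fun k => affine_poly_size _ _ _ _).
have Sp i V : triangle (subvertices A i) V -> S V = evalp p V.
  move=> Vi; have [l lV l0] := Vi; rewrite (SE i _ l)// pE.
  rewrite bezier_extended; last by case: lV.
  congr bezier; apply/funext => k; rewrite /q affine_polyE.
  have /lE/(_ (k + 1)) := barycentric_subvertices _ _ _ _ _ lV.
  rewrite (_ : i + 2 = i + 1 + 1); last by rewrite -addrA.
  rewrite !(inj_eq (addIr 1)) => lk.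
  rewrite [l 1 * _ + _ + _]lk; ring.
have SK V : triangle A V -> S V = evalp p V.
  by case/triangle_subvertices => i; exact: Sp.
split; last exact: Ck_evalp SK.
split; first exact: within_continuous_evalp SK.
by move=> i; exists p; [exact: leq_trans p4 _|exact: Sp].
Qed.
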